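(* Let $R$ be a semiprime left Goldie ring and $\mathcal{N}=\{S\in\max\mathbb{L}_l(R):\mathcal{C}_R\subseteq S\}$. Then $\mathcal{N}=\max\mathrm{Den}_l(R)=\{\mathcal{C}(\mathfrak{p}):\mathfrak{p}\in\min(R)\}$, where $\mathcal{C}(\mathfrak{p})=\{c\in R: c+\mathfrak{p}\in\mathcal{C}_{R/\mathfrak{p}}\}$.
   Context: Rings are associative with $1$. $\mathcal{C}_A$ denotes the set of regular elements (non-zero-divisors on both sides) of a ring $A$; $\min(R)$ the set of minimal prime ideals of $R$. Multiplicative set: $SS\subseteq S$, $1\in S$, $0\notin S$. Left denominator set: $Sr\cap Rs\ne\emptyset$ for all $r\in R,s\in S$, and $rs=0$ ($s\in S$) implies $tr=0$ for some $t\in S$; $\max\mathrm{Den}_l(R)$ is the set of maximal left denominator sets w.r.t. inclusion. $R\langle S^{-1}\rangle=R\langle X_S\rangle/I_S$ with $R\langle X_S\rangle$ freely generated by $R$ and noncommuting indeterminates $x_s$ ($s\in S$) and $I_S$ generated by $sx_s-1,x_ss-1$. $S$ is left localizable if $R\langle S^{-1}\rangle\neq0$ and every element has the form $(x_s+I_S)(r+I_S)$; $\mathbb{L}_l(R)$ is the set of left localizable sets and $\max\mathbb{L}_l(R)$ its maximal elements w.r.t. inclusion. *)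

(* Defs.v *)
From HB Require Import structures.
From mathcomp Require Import all_boot all_order all_algebra.
Set Implicit Arguments. Unset Strict Implicit. Unset Printing Implicit Defensive.
Import GRing.Theory.
Local Open Scope ring_scope.

Definition subset_of {T : Type} (A B : T -> Prop) := forall x, A x -> B x.

Section RingDefs.
Variable R : pzRingType.

Definition regular (c : R) : Prop :=
  (forall x : R, c * x = 0 -> x = 0) /\ (forall x : R, x * c = 0 -> x = 0).

Definition is_ideal (I : R -> Prop) : Prop :=
  I 0 /\ (forall x y, I x -> I y -> I (x - y)) /\
  (forall r x, I x -> I (r * x)) /\ (forall r x, I x -> I (x * r)).

Definition is_left_ideal (L : R -> Prop) : Prop :=
  L 0 /\ (forall x y, L x -> L y -> L (x - y)) /\ (forall r x, L x -> L (r * x)).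

Definition prime_ideal (P : R -> Prop) : Prop :=
  is_ideal P /\ ~ P 1 /\
  forall I J : R -> Prop, is_ideal I -> is_ideal J ->
    (forall i j, I i -> J j -> P (i * j)) -> subset_of I P \/ subset_of J P.

Definition minimal_prime (P : R -> Prop) : Prop :=
  prime_ideal P /\ forall Q, prime_ideal Q -> subset_of Q P -> subset_of P Q.

(* C(p) = { c : c + p is regular in R/p }, written out without forming R/p *)
Definition C_of (P : R -> Prop) (c : R) : Prop :=
  (forall x, P (c * x) -> P x) /\ (forall x, P (x * c) -> P x).

Definition semiprime : Prop :=
  forall I, is_ideal I -> (forall a b, I a -> I b -> a * b = 0) ->
    forall a, I a -> a = 0.

Definition lann (X : R -> Prop) (r : R) : Prop := forall x, X x -> r * x = 0.

Definition acc_left_annihilators : Prop :=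
  forall X : nat -> R -> Prop,
    (forall n, subset_of (lann (X n)) (lann (X n.+1))) ->
    exists N, forall n, (N <= n)%N -> subset_of (lann (X n)) (lann (X N)).

Definition independent_left_ideals (L : nat -> R -> Prop) : Prop :=
  forall (n : nat) (a : nat -> R), (forall i, (i <= n)%N -> L i (a i)) ->
    \sum_(i < n.+1) a i = 0 -> forall i, (i <= n)%N -> a i = 0.

Definition finite_uniform_dimension : Prop :=
  ~ exists L : nat -> R -> Prop,
      (forall n, is_left_ideal (L n)) /\ (forall n, exists x, L n x /\ x <> 0) /\
      independent_left_ideals L.

Definition left_Goldie : Prop := acc_left_annihilators /\ finite_uniform_dimension.

Definition multiplicative (S : R -> Prop) : Prop :=
  S 1 /\ ~ S 0 /\ forall s t, S s -> S t -> S (s * t).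

Definition left_Ore (S : R -> Prop) : Prop :=
  forall r s, S s -> exists s' r', S s' /\ s' * r = r' * s.

Definition left_reversible (S : R -> Prop) : Prop :=
  forall r s, S s -> r * s = 0 -> exists t, S t /\ t * r = 0.

Definition left_denominator (S : R -> Prop) : Prop :=
  multiplicative S /\ left_Ore S /\ left_reversible S.

Definition is_rmorph {A B : pzRingType} (f : A -> B) : Prop :=
  (forall x y, f (x - y) = f x - f y) /\ (forall x y, f (x * y) = f x * f y) /\ f 1 = 1.

Definition invertible {A : pzRingType} (a : A) : Prop := exists b, a * b = 1 /\ b * a = 1.

(* (A, phi) is the universal S-inverting ring R<S^{-1}> = R<X_S>/I_S,
   characterised up to isomorphism by its universal property. *)
Definition universal_inverting (S : R -> Prop) (A : pzRingType) (phi : R -> A) : Prop :=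
  is_rmorph phi /\ (forall s, S s -> invertible (phi s)) /\
  forall (B : pzRingType) (psi : R -> B), is_rmorph psi ->
    (forall s, S s -> invertible (psi s)) ->
    (exists theta : A -> B, is_rmorph theta /\ forall r, theta (phi r) = psi r) /\
    (forall theta1 theta2 : A -> B, is_rmorph theta1 -> is_rmorph theta2 ->
       (forall r, theta1 (phi r) = psi r) -> (forall r, theta2 (phi r) = psi r) ->
       forall a, theta1 a = theta2 a).

Definition left_localizable (S : R -> Prop) : Prop :=
  multiplicative S /\
  exists (A : pzRingType) (phi : R -> A), universal_inverting S phi /\
    (1 : A) <> 0 /\
    forall a : A, exists s r (x : A), S s /\ phi s * x = 1 /\ x * phi s = 1 /\
                                      a = x * phi r.

Definition maximal_in (P : (R -> Prop) -> Prop) (S : R -> Prop) : Prop :=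
  P S /\ forall T, P T -> subset_of S T -> subset_of T S.

Definition max_left_denominator := maximal_in left_denominator.
Definition max_left_localizable := maximal_in left_localizable.

End RingDefs.

(* Main.v *)
From HB Require Import structures.
Require Import Defs.
From mathcomp Require Import all_boot all_order all_algebra.
From mathcomp Require Import boolp.

(* A proper ideal A of a semiprime left Goldie ring without regular elements has a
   nonzero annihilator B, since A + ann A is essential as a left ideal and so
   contains a regular element. The annihilator p of an ideal C of B with maximal
   annihilator is then a minimal prime, and regularity modulo A passes to regularity
   modulo p because A and B meet in 0. Applying this to the S-torsion ideal of a left
   denominator set S, respectively to the kernel of R -> R<S^-1> for a left
   localizable S containing the regular elements, places S inside some C(p).
   Conversely each C(p) is a left denominator set, hence left localizable by Ore's
   construction, and these sets are pairwise incomparable: if y in ann p is regular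
   modulo p, then y lies in every minimal prime other than p. *)

Set Implicit Arguments. Unset Strict Implicit. Unset Printing Implicit Defensive.
Import GRing.Theory.
Local Open Scope ring_scope.

(** * Ore localization *)

Section OreLocalization.
Variables (R : pzRingType) (S : R -> Prop).

Definition torsion (r : R) : Prop := exists t, S t /\ t * r = 0.

(* A fraction q is encoded by its graph {(a, b) | a q = b}, an S-saturated left
   submodule of R x R; equality of fractions is then equality of graphs. *)
Record fraction_graph (G : R -> R -> Prop) : Prop := FractionGraph {
  graphB : forall a b a' b', G a b -> G a' b' -> G (a - a') (b - b');
  graphM : forall r a b, G a b -> G (r * a) (r * b);
  graph_sat : forall t a b, S t -> G (t * a) (t * b) -> G a b;
  graph_torsion : forall b, G 0 b -> torsion b;
  graph_dom : exists s b, S s /\ G s b }.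

Hypothesis S_den : left_denominator S.

Let S1 : S 1. Proof. by case: S_den => -[]. Qed.
Let S0 : ~ S 0. Proof. by case: S_den => -[_ []]. Qed.
Let SM s t : S s -> S t -> S (s * t). Proof. case: S_den => -[_ [_ h]] _; exact: h. Qed.
Let ore : left_Ore S. Proof. by case: S_den => _ []. Qed.
Let rev : left_reversible S. Proof. by case: S_den => _ []. Qed.

(** The Ore condition supplies a common left multiple in [S] of two annihilating elements, and moves
    an annihilator of [x] past [r] to one of [r * x]. *)
Lemma torsion_ideal : is_ideal torsion.
Proof.
split; first by exists 1; split=> //; rewrite mulr0.
split=> [x y [t [St tx]] [u [Su uy]]|].
  have [s [r [Ss sr]]] := ore t Su.
  exists (s * t); split; first exact: SM.
  by rewrite mulrBr -mulrA tx mulr0 sr -mulrA uy mulr0 subr0.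
split=> r x [t [St tx]].
  have [s [r' [Ss sr]]] := ore r St.
  by exists s; split=> //; rewrite mulrA sr -mulrA tx mulr0.
by exists t; rewrite mulrA tx mul0r.
Qed.

Lemma torsionMl s x : S s -> torsion (s * x) -> torsion x.
Proof. by move=> Ss [t [St e]]; exists (t * s); rewrite -mulrA; split=> //; apply: SM. Qed.

Lemma torsionMr s x : S s -> torsion (x * s) -> torsion x.
Proof.
move=> Ss [t [St]]; rewrite mulrA => /(rev Ss) [u [Su e]].
by exists (u * t); rewrite -mulrA; split=> //; apply: SM.
Qed.

Lemma torsion_proper : ~ torsion 1.
Proof. by case=> t [St]; rewrite mulr1 => t0; apply: S0; rewrite -t0. Qed.

Lemma torsion_C_of s : S s -> C_of torsion s.
Proof. by move=> Ss; split=> x; [apply: torsionMl | apply: torsionMr]. Qed.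

Let tors0 : torsion 0. Proof. by case: torsion_ideal. Qed.
Let torsB x y : torsion x -> torsion y -> torsion (x - y).
Proof. case: torsion_ideal => _ [h _]; exact: h. Qed.
Let torsMl r x : torsion x -> torsion (r * x).
Proof. case: torsion_ideal => _ [_ [h _]]; exact: h. Qed.

(** * Calculus in a single fraction graph *)

Section Graph.
Variables (G : R -> R -> Prop) (hG : fraction_graph G).

Lemma graph0 : G 0 0.
Proof. by have [s [b [_ h]]] := graph_dom hG; have := graphB hG h h; rewrite !subrr. Qed.

Lemma graphN a b : G a b -> G (- a) (- b).
Proof. by move=> h; have := graphB hG graph0 h; rewrite !sub0r. Qed.

Lemma graphD a b a' b' : G a b -> G a' b' -> G (a + a') (b + b').
Proof. by move=> h /graphN h'; have := graphB hG h h'; rewrite !opprK. Qed.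

Lemma torsion_graph b : torsion b -> G 0 b.
Proof.
by case=> t [St e]; apply: (graph_sat hG St); rewrite e mulr0; apply: graph0.
Qed.

Lemma graph_fun a b b' : G a b -> G a b' -> torsion (b - b').
Proof. by move=> h h'; apply: (graph_torsion hG); rewrite -(subrr a); apply: (graphB hG). Qed.

Lemma graph_eqr a b b' : G a b -> torsion (b - b') -> G a b'.
Proof.
move=> h /torsion_graph h'; have := graphB hG h h'.
by rewrite subr0 opprB addrC subrK.
Qed.

Lemma graph_dense r : exists t b, S t /\ G (t * r) b.
Proof.
have [s [b [Ss h]]] := graph_dom hG; have [t [r' [St e]]] := ore r Ss.
by exists t, (r' * b); rewrite e; split=> //; apply: graphM.
Qed.
End Graph.

(** One value at one denominator [s] determines a fraction: some [t * a] is a left multiple of [s],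
    values there agree up to torsion, and saturation cancels [t]. Every ring identity below is
    therefore checked at one common denominator. *)
Lemma graph_sub G H s b : fraction_graph G -> fraction_graph H -> S s ->
  G s b -> H s b -> forall a c, G a c -> H a c.
Proof.
move=> hG hH Ss Gs Hs a c Gac; have [t [r [St e]]] := ore a Ss.
apply: (graph_sat hH St); rewrite e; apply: (graph_eqr hH (graphM hH r Hs)).
by apply: (graph_fun hG (a := r * s)); [|rewrite -e]; apply: graphM.
Qed.

Record frac := Frac { graph : R -> R -> Prop; graphP : fraction_graph graph }.

Lemma fracP p q s b : S s -> graph p s b -> graph q s b -> p = q.
Proof.
case: p q => [G hG] [H hH] /= Ss Gs Hs.
suff e : G = H by subst H; congr Frac; exact: Prop_irrelevance.
apply/funext => a; apply/funext => c; apply/propext.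
by split; [apply: (graph_sub hG hH Ss Gs Hs) | apply: (graph_sub hH hG Ss Hs Gs)].
Qed.

Lemma graph_dense2 p q r :
  exists t b c, [/\ S t, graph p (t * r) b & graph q (t * r) c].
Proof.
have [t [b [St h]]] := graph_dense (graphP p) r.
have [u [c [Su h']]] := graph_dense (graphP q) (t * r).
exists (u * t), (u * b), c; rewrite -!mulrA; split; [exact: SM| |exact: h'].
exact: (graphM (graphP p)).
Qed.

(** * Ring structure on fractions *)

Lemma of_subproof r : fraction_graph (fun a b => torsion (a * r - b)).
Proof.
split=> [a b a' b' h h'|u a b h|t a b St|b|].
- by rewrite mulrBl opprD addrACA -opprD; apply: torsB.
- by rewrite -mulrA -mulrBr; apply: torsMl.
- by rewrite -mulrA -mulrBr; apply: torsionMl.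
- by rewrite mul0r sub0r => /(torsB tors0); rewrite sub0r opprK.
- by exists 1, r; split=> //; rewrite mul1r subrr.
Qed.
Definition frac_of r : frac := Frac (of_subproof r).

(** For [q] the inverse of [s], the equation [a q = b] reads [a = b s]. Reversibility enters in the
    torsion condition, where [s] is cancelled on the right. *)
Lemma inv_subproof s : S s -> fraction_graph (fun a b => torsion (a - b * s)).
Proof.
move=> Ss; split=> [a b a' b' h h'|u a b h|t a b St|b|].
- by rewrite mulrBl opprD addrACA -opprD; apply: torsB.
- by rewrite -mulrA -mulrBr; apply: torsMl.
- by rewrite -mulrA -mulrBr; apply: torsionMl.
- rewrite sub0r => /(torsB tors0); rewrite sub0r opprK; exact: torsionMr.
- by exists s, 1; split=> //; rewrite mul1r subrr.
Qed.
Definition frac_inv s (Ss : S s) : frac := Frac (inv_subproof Ss).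

Lemma opp_subproof p : fraction_graph (fun a b => graph p a (- b)).
Proof.
have hp := graphP p.
split=> [a b a' b' h h'|u a b h|t a b St|b|].
- by rewrite opprD; apply: graphB.
- by rewrite -mulrN; apply: graphM.
- by rewrite -mulrN; apply: graph_sat.
- by move=> /(graph_torsion hp)/(torsB tors0); rewrite sub0r opprK.
- have [s [b [Ss h]]] := graph_dom hp.
  by exists s, (- b); rewrite opprK.
Qed.
Definition frac_opp p := Frac (opp_subproof p).

(** Pointwise addition of partial maps; the multiplier [t] brings [a] into both domains and makes
    the graph saturated. *)
Definition add_graph p q a c := exists t b b',
  [/\ S t, graph p (t * a) b, graph q (t * a) b' & t * c = b + b'].

Lemma add_subproof p q : fraction_graph (add_graph p q).
Proof.
have hp := graphP p; have hq := graphP q.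
split.
- move=> a c a' c' [t [b [d [St h1 h2 e]]]] [t' [b' [d' [St' h1' h2' e']]]].
  have [s [r [Ss sr]]] := ore t St'.
  exists (s * t), (s * b - r * b'), (s * d - r * d'); split.
  + exact: SM.
  + rewrite mulrBr {2}sr -!mulrA; apply: graphB=> //; exact: graphM.
  + rewrite mulrBr {2}sr -!mulrA; apply: graphB=> //; exact: graphM.
  + by rewrite mulrBr {2}sr -!mulrA e e' !mulrDr opprD addrACA.
- move=> u a c [t [b [d [St h1 h2 e]]]].
  have [s [r [Ss sr]]] := ore u St.
  exists s, (r * b), (r * d); rewrite !mulrA sr -!mulrA e mulrDr; split=> //; exact: graphM.
- move=> u a c Su [t [b [d [St h1 h2 e]]]].
  by exists (t * u), b, d; rewrite -!mulrA; split=> //; apply: SM.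
- move=> c [t [b [d [St h1 h2 e]]]].
  apply: (torsionMl St); rewrite e -[d]opprK; apply: torsB.
    by rewrite mulr0 in h1; apply: graph_torsion h1.
  by rewrite mulr0 in h2; rewrite -sub0r; apply: torsB => //; apply: graph_torsion h2.
- have [t [b [c [St h h']]]] := graph_dense2 p q 1.
  exists t, (b + c); split=> //; exists 1, b, c.
  by rewrite !mul1r; rewrite mulr1 in h h'.
Qed.
Definition frac_add p q := Frac (add_subproof p q).

(** Composition of partial maps, first [p] and then [q], saturated by [t]. *)
Definition mul_graph p q a c := exists t b,
  [/\ S t, graph p (t * a) b & graph q b (t * c)].

Lemma mul_subproof p q : fraction_graph (mul_graph p q).
Proof.
have hp := graphP p; have hq := graphP q.
split.
- move=> a c a' c' [t [b [St h1 h2]]] [t' [b' [St' h1' h2']]].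
  have [s [r [Ss sr]]] := ore t St'.
  exists (s * t), (s * b - r * b'); split.
  + exact: SM.
  + rewrite mulrBr {2}sr -!mulrA; apply: graphB=> //; exact: graphM.
  + rewrite mulrBr {2}sr -!mulrA; apply: graphB=> //; exact: graphM.
- move=> u a c [t [b [St h1 h2]]].
  have [s [r [Ss sr]]] := ore u St.
  exists s, (r * b); rewrite !mulrA sr -!mulrA; split=> //; exact: graphM.
- move=> u a c Su [t [b [St h1 h2]]].
  by exists (t * u), b; rewrite -!mulrA; split=> //; apply: SM.
- move=> c [t [b [St h1 h2]]]; rewrite mulr0 in h1.
  have [u [Su ub]] := graph_torsion hp h1.
  have /(graph_torsion hq) : graph q 0 (u * (t * c)) by rewrite -ub; apply: graphM.
  by move/(torsionMl Su)/(torsionMl St).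
- have [s [b [Ss h]]] := graph_dom hp.
  have [t [c [St h']]] := graph_dense hq b.
  exists (t * s), c; split; first exact: SM.
  by exists 1, (t * b); rewrite !mul1r; split=> //; apply: graphM.
Qed.
Definition frac_mul p q := Frac (mul_subproof p q).

Lemma graph_add p q a b c : graph p a b -> graph q a c -> graph (frac_add p q) a (b + c).
Proof. by move=> h h'; exists 1, b, c; rewrite !mul1r. Qed.

Lemma graph_mul p q a b c : graph p a b -> graph q b c -> graph (frac_mul p q) a c.
Proof. by move=> h h'; exists 1, b; rewrite !mul1r. Qed.

Lemma graph_of a r : graph (frac_of r) a (a * r).
Proof. by rewrite /= subrr. Qed.

Lemma graph_of1 r : graph (frac_of r) 1 r.
Proof. by rewrite -[X in graph _ _ X]mul1r; apply: graph_of. Qed.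

Lemma graph_opp p a b : graph p a b -> graph (frac_opp p) a (- b).
Proof. by rewrite /= opprK. Qed.

Lemma graph_dense3 p q r :
  exists t b c d, [/\ S t, graph p t b, graph q t c & graph r t d].
Proof.
have [t [b [c [St h h']]]] := graph_dense2 p q 1; rewrite mulr1 in h h'.
have [u [d [Su h'']]] := graph_dense (graphP r) t.
exists (u * t), (u * b), (u * c), d.
by split=> //; [exact: SM| |]; apply: graphM => //; apply: graphP.
Qed.

Lemma frac_addA : associative frac_add.
Proof.
move=> p q r; have [t [b [c [d [St hp hq hr]]]]] := graph_dense3 p q r.
apply: (fracP (b := b + c + d) St); last by do !apply: graph_add.
by rewrite -addrA; do !apply: graph_add.
Qed.

Lemma frac_addC : commutative frac_add.
Proof.
move=> p q; have [t [b [c [d [St hp hq _]]]]] := graph_dense3 p q p.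
by apply: (fracP (b := b + c) St); [|rewrite addrC]; apply: graph_add.
Qed.

Lemma frac_add0 : left_id (frac_of 0) frac_add.
Proof.
move=> p; have [t [b [St hp]]] := graph_dom (graphP p).
apply: (fracP (b := t * 0 + b) St); last by rewrite mulr0 add0r.
by apply: graph_add => //; apply: graph_of.
Qed.

Lemma frac_addN : left_inverse (frac_of 0) frac_opp frac_add.
Proof.
move=> p; have [t [b [St hp]]] := graph_dom (graphP p).
apply: (fracP (b := - b + b) St); first by apply: graph_add => //; apply: graph_opp.
by rewrite addNr; have := graph_of t 0; rewrite mulr0.
Qed.

Lemma frac_mulA : associative frac_mul.
Proof.
move=> p q r; have [t [b [St hp]]] := graph_dom (graphP p).
have [u [c [Su hq]]] := graph_dense (graphP q) b.
have [v [d [Sv hr]]] := graph_dense (graphP r) c.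
have hq' := graphM (graphP q) v hq.
have hp' := graphM (graphP p) v (graphM (graphP p) u hp).
apply: (fracP (b := d) (SM Sv (SM Su St))).
  by apply: graph_mul hp' _; apply: graph_mul hq' _.
by apply: graph_mul hr; apply: graph_mul hp' _.
Qed.

Lemma frac_mul1l : left_id (frac_of 1) frac_mul.
Proof.
move=> p; have [t [b [St hp]]] := graph_dom (graphP p).
by apply: (fracP St _ hp); apply: graph_mul (graph_of _ _) _; rewrite mulr1.
Qed.

Lemma frac_mul1r : right_id (frac_of 1) frac_mul.
Proof.
move=> p; have [t [b [St hp]]] := graph_dom (graphP p).
by apply: (fracP St _ hp); apply: graph_mul hp _;
  rewrite -[X in graph _ _ X]mulr1; apply: graph_of.
Qed.

Lemma frac_mulDl : left_distributive frac_mul frac_add.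
Proof.
move=> p q r; have [t [b [c [_ [St hp hq _]]]]] := graph_dense3 p q p.
have [u [d [Su hb]]] := graph_dense (graphP r) b.
have [v [e [Sv hc]]] := graph_dense (graphP r) (u * c).
have hb' := graphM (graphP r) v hb.
have hp' := graphM (graphP p) v (graphM (graphP p) u hp).
have hq' := graphM (graphP q) v (graphM (graphP q) u hq).
apply: (fracP (b := v * d + e) (SM Sv (SM Su St))).
  by apply: graph_mul (graph_add hp' hq') _; apply: graphD => //; apply: graphP.
by apply: graph_add; [apply: graph_mul hp' _|apply: graph_mul hq' _].
Qed.

Lemma frac_mulDr : right_distributive frac_mul frac_add.
Proof.
move=> p q r; have [t [b [St hp]]] := graph_dom (graphP p).
have [u [c [d [Su hq hr]]]] := graph_dense2 q r b.
have hp' := graphM (graphP p) u hp.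
apply: (fracP (b := c + d) (SM Su St)).
  by apply: graph_mul hp' _; apply: graph_add.
by apply: graph_add; apply: graph_mul hp' _.
Qed.

HB.instance Definition _ := gen_eqMixin frac.
HB.instance Definition _ := gen_choiceMixin frac.
HB.instance Definition _ :=
  GRing.isZmodule.Build frac frac_addA frac_addC frac_add0 frac_addN.
HB.instance Definition _ := GRing.Zmodule_isPzRing.Build frac
  frac_mulA frac_mul1l frac_mul1r frac_mulDl frac_mulDr.

Lemma frac_of_rmorph : is_rmorph frac_of.
Proof.
split=> [x y|].
  apply: (fracP (b := x - y) S1); first exact: graph_of1.
  by apply: (graph_add (graph_of1 x)); apply: graph_opp; apply: graph_of1.
split=> // x y.
apply: (fracP (b := 1 * (x * y)) S1); first exact: graph_of.
by rewrite mulrA; apply: graph_mul (graph_of _ _) (graph_of _ _).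
Qed.

Lemma frac_invM s (Ss : S s) : frac_inv Ss * frac_of s = 1.
Proof.
apply: (fracP (b := 1 * s) Ss); last first.
  by rewrite mul1r -[X in graph _ _ X]mulr1; apply: graph_of.
apply: graph_mul (graph_of _ _); by rewrite /= mul1r subrr.
Qed.

Lemma frac_ofM s (Ss : S s) : frac_of s * frac_inv Ss = 1.
Proof.
apply: (fracP (b := 1 * 1) S1); last exact: graph_of.
by apply: graph_mul (graph_of _ _) _; rewrite /= !mul1r subrr.
Qed.

Lemma graph_eq (q : frac) a b : graph q a b -> frac_of a * q = frac_of b.
Proof.
move=> h; apply: (fracP (b := b) S1); last exact: graph_of1.
by apply: graph_mul (graph_of _ _) _; rewrite mul1r.
Qed.

Lemma frac_nontrivial : (1 : frac) <> 0.
Proof.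
move=> e; have := graph_of 1 1; rewrite -/(graph 1 _ _) [frac_of 1]e /= mulr0 sub0r mul1r.
by move=> /(torsB tors0); rewrite sub0r opprK; apply: torsion_proper.
Qed.

(** * Universal property of the ring of fractions *)

Section Universal.
Variables (B : pzRingType) (psi : R -> B).
Hypothesis psi_morph : is_rmorph psi.
Hypothesis psi_inv : forall s, S s -> invertible (psi s).

Let psiB x y : psi (x - y) = psi x - psi y. Proof. by case: psi_morph. Qed.
Let psiM x y : psi (x * y) = psi x * psi y. Proof. by case: psi_morph => _ []. Qed.
Let psi1 : psi 1 = 1. Proof. by case: psi_morph => _ []. Qed.
Let psi_0 : psi 0 = 0. Proof. by rewrite -(subrr 0) psiB subrr. Qed.

Let psi_cancel s x y : S s -> psi s * x = psi s * y -> x = y.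
Proof.
by move=> /psi_inv [u [_ us]] e; rewrite -[x]mul1r -us -mulrA e mulrA us mul1r.
Qed.

Let psi_torsion x : torsion x -> psi x = 0.
Proof.
by case=> t [St e]; apply: (psi_cancel St); rewrite -psiM e mulr0.
Qed.

(** One pair [(s, r)] of the graph dictates that [b] be the inverse of [psi s] times [psi r]. The
    other pairs are compared with it by the Ore condition, since [psi] kills torsion. *)
Lemma frac_lift_ex (q : frac) : exists b, forall a c, graph q a c -> psi a * b = psi c.
Proof.
have [s [r [Ss h]]] := graph_dom (graphP q).
have [u [su us]] := psi_inv Ss.
exists (u * psi r) => a c hac; have [t [r' [St e]]] := ore a Ss.
apply: (psi_cancel St); rewrite mulrA -!psiM e psiM -mulrA (mulrA (psi s)) su mul1r.
apply/eqP; rewrite -subr_eq0 -psiM -psiB; apply/eqP/psi_torsion.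
apply: (graph_fun (graphP q) (a := r' * s)); first exact: graphM (graphP q) _ _ _ h.
rewrite -e; exact: graphM (graphP q) _ _ _ hac.
Qed.

Definition frac_lift q := sval (cid (frac_lift_ex q)).

Lemma frac_liftP q a c : graph q a c -> psi a * frac_lift q = psi c.
Proof. exact: (svalP (cid (frac_lift_ex q))). Qed.

Lemma frac_lift_eq q s c b : S s -> graph q s c -> psi s * b = psi c -> frac_lift q = b.
Proof. by move=> Ss h e; apply: (psi_cancel Ss); rewrite (frac_liftP h). Qed.

Lemma frac_lift_of r : frac_lift (frac_of r) = psi r.
Proof. by apply: (frac_lift_eq S1 (graph_of 1 r)); rewrite psiM. Qed.

Lemma frac_lift_rmorph : is_rmorph frac_lift.
Proof.
split=> [p q|].
  have [t [b [c [_ [St hp hq _]]]]] := graph_dense3 p q p.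
  apply: (frac_lift_eq St (graph_add hp (graph_opp hq))).
  by rewrite mulrBr (frac_liftP hp) (frac_liftP hq) psiB.
split; last by rewrite -psi1; apply: frac_lift_of.
move=> p q; have [t [b [St hp]]] := graph_dom (graphP p).
have [u [c [Su hq]]] := graph_dense (graphP q) b.
have hp' := graphM (graphP p) u hp.
by apply: (frac_lift_eq (SM Su St) (graph_mul hp' hq));
  rewrite mulrA (frac_liftP hp') (frac_liftP hq).
Qed.
End Universal.

Lemma frac_universal : universal_inverting S frac_of.
Proof.
split; first exact: frac_of_rmorph.
split=> [s Ss|B psi psi_morph psi_inv].
  by exists (frac_inv Ss); rewrite frac_ofM frac_invM.
split.
  exists (frac_lift psi_morph psi_inv); split; [exact: frac_lift_rmorph | exact: frac_lift_of].
move=> f g [_ [fM _]] [_ [gM _]] fpsi gpsi q.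
have [s [r [Ss /graph_eq h]]] := graph_dom (graphP q).
have [u [_ us]] := psi_inv s Ss.
(* Both sides equal [psi r], and [psi s] is invertible, so the lift is unique. *)
have e : psi s * f q = psi s * g q.
  by rewrite -{1}fpsi -gpsi -fM -gM h fpsi gpsi.
by rewrite -[f q]mul1r -us -mulrA e mulrA us mul1r.
Qed.

Lemma left_denominator_localizable : left_localizable S.
Proof.
split; first by case: S_den.
exists frac, frac_of; split; first exact: frac_universal.
split; first exact: frac_nontrivial.
move=> q; have [s [r [Ss /graph_eq h]]] := graph_dom (graphP q).
exists s, r, (frac_inv Ss); rewrite frac_ofM frac_invM; split=> //; split=> //; split=> //.
by rewrite -h mulrA frac_invM mul1r.
Qed.

End OreLocalization.

(** * Annihilators and minimal primes *)

Section Annihilators.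
Variable R : pzRingType.
Implicit Types (a b c r s x y z : R) (I J P Q X : R -> Prop).

Definition rann X x : Prop := forall y, X y -> y * x = 0.

Lemma subset_anti X Y : subset_of X Y -> subset_of Y X -> X = Y.
Proof. by move=> XY YX; apply/predeqP => x; split; [apply: XY | apply: YX]. Qed.

Lemma ideal_add I x y : is_ideal I -> I x -> I y -> I (x + y).
Proof.
move=> [I0 [IB _]] Ix Iy; rewrite -[y]opprK; apply: (IB _ _ Ix).
by rewrite -sub0r; apply: IB.
Qed.

Lemma setT_ideal : is_ideal (fun _ : R => True).
Proof. by []. Qed.

Lemma lann_ideal I : is_ideal I -> is_ideal (lann I).
Proof.
move=> [_ [_ [Il _]]]; split=> [x _|]; first by rewrite mul0r.
split=> [x y hx hy z Iz|]; first by rewrite mulrBl hx // hy // subr0.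
by split=> r x hx z Iz; [rewrite -mulrA hx // mulr0 | rewrite -mulrA hx //; apply: Il].
Qed.

Lemma rann_ideal I : is_ideal I -> is_ideal (rann I).
Proof.
move=> [_ [_ [_ Ir]]]; split=> [x _|]; first by rewrite mulr0.
split=> [x y hx hy z Iz|]; first by rewrite mulrBr hx // hy // subr0.
by split=> r x hx z Iz; [rewrite mulrA hx //; apply: Ir | rewrite mulrA hx // mul0r].
Qed.

Lemma lann_antitone X Y : subset_of X Y -> subset_of (lann Y) (lann X).
Proof. by move=> XY r h x /XY; apply: h. Qed.

(** As an intersection of ideals, this needs no finite sums: a property of its elements is proved by
    testing an ideal that contains [X]. *)
Definition ideal_gen X z : Prop := forall I, is_ideal I -> subset_of X I -> I z.

Lemma ideal_gen_ideal X : is_ideal (ideal_gen X).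
Proof.
split=> [I [] //|]; split=> [x y hx hy I hI e|].
  by case: (hI) => _ [IB _]; apply: IB; [apply: hx|apply: hy].
by split=> r x hx I hI e; case: (hI) => _ [_ [Il Ir]]; [apply: Il|apply: Ir]; apply: hx.
Qed.

Lemma ideal_gen_sub X I : is_ideal I -> subset_of X I -> subset_of (ideal_gen X) I.
Proof. by move=> hI XI z; apply. Qed.

Lemma ideal_gen_in X : subset_of X (ideal_gen X).
Proof. by move=> x Xx I _; apply. Qed.

Definition ideal_mul I J : R -> Prop :=
  ideal_gen (fun z => exists x y, [/\ I x, J y & z = x * y]).

Lemma ideal_mul_in I J x y : I x -> J y -> ideal_mul I J (x * y).
Proof. by move=> Ix Jy; apply: ideal_gen_in; exists x, y. Qed.

Lemma ideal_mul_subr I J : is_ideal J -> subset_of (ideal_mul I J) J.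
Proof.
move=> hJ; apply: ideal_gen_sub => // _ [x [y [_ Jy ->]]].
by case: hJ => _ [_ [Jl _]]; apply: Jl.
Qed.

Lemma sub_lann_ideal_mul I J K : is_ideal I ->
  (forall x y z, I x -> J y -> K z -> x * (y * z) = 0) ->
  subset_of I (lann (ideal_mul J K)).
Proof.
move=> hI h x Ix z hz; have : rann I z; last exact.
apply: (ideal_gen_sub (rann_ideal hI)) hz => _ [y [w [Jy Kw ->]]] v Iv; exact: h.
Qed.

(** Without a maximal member, a choice function iterated from [X0] gives a strictly ascending chain
    of left annihilators. *)
Lemma acc_maximal (F : (R -> Prop) -> Prop) X0 : acc_left_annihilators R -> F X0 ->
  exists X, F X /\
    forall Y, F Y -> subset_of (lann X) (lann Y) -> subset_of (lann Y) (lann X).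
Proof.
move=> acc F0; apply: contrapT => nmax.
have /choice[f fP] : forall X, exists Y, F X ->
    [/\ F Y, subset_of (lann X) (lann Y) & ~ subset_of (lann Y) (lann X)].
  move=> X; apply: contrapT => nY; apply: nmax; exists X; split.
    by apply: contrapT => nF; apply: nY; exists X => /nF.
  by move=> Y FY XY; apply: contrapT => nYX; apply: nY; exists Y.
have Fn n : F (iter n f X0) by elim: n => //= n /fP[].
have [n|N /(_ N.+1 (leqnSn N)) h] := acc (fun n => iter n f X0).
  by case: (fP _ (Fn n)).
by case: (fP _ (Fn N)).
Qed.

End Annihilators.

(** * Annihilator ideals of a semiprime ring *)

Section Semiprime.
Variable R : pzRingType.
Hypothesis semiprimeR : semiprime R.
Implicit Types (a b c r s x y z : R) (A B C I J P Q X : R -> Prop).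

(** The ideal generated by [a] has square zero. The [x] with [x R a = 0] form an ideal containing
    [a], so [a] is in the right annihilator of the generated ideal, which is again an ideal. *)
Lemma semiprime_eq0 a : (forall r, a * r * a = 0) -> a = 0.
Proof.
move=> aRa; apply: (semiprimeR (ideal_gen_ideal (fun x => x = a))); last exact: ideal_gen_in.
have hl x : ideal_gen (fun x => x = a) x -> forall r, x * r * a = 0.
  move=> hx; have hK : is_ideal (fun x => forall r, x * r * a = 0).
    split=> [r|]; first by rewrite !mul0r.
    split=> [y z hy hz r|]; first by rewrite !mulrBl hy hz subr0.
    by split=> s y hy r; [rewrite -!mulrA (mulrA y) hy mulr0 | rewrite -(mulrA y) hy].
  by apply: (hx _ hK) => y ->.
move=> x y hx hy; have hI := ideal_gen_ideal (fun x => x = a).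
have hy' : rann (ideal_gen (fun x => x = a)) y.
  by apply: (hy _ (rann_ideal hI)) => _ -> z hz; rewrite -[z]mulr1 hl.
exact: hy'.
Qed.

Lemma lann_rann I : is_ideal I -> lann I = rann I.
Proof.
move=> [_ [_ [Il Ir]]]; apply: subset_anti => x hx y Iy; apply: semiprime_eq0 => r.
  by rewrite -!mulrA (mulrA r) (mulrA x) hx ?mul0r ?mulr0 //; apply: Il.
by rewrite -!mulrA (mulrA y) (mulrA (y * r)) hx ?mul0r ?mulr0 //; apply: Ir.
Qed.

Lemma ideal_lann_eq0 I x : is_ideal I -> I x -> lann I x -> x = 0.
Proof.
move=> [_ [_ [Il _]]] Ix hx; apply: semiprime_eq0 => r.
by rewrite -mulrA hx //; apply: Il.
Qed.

(** If [c * x] kills [C] and [y] is in [C], then [c * (x * y) = 0] puts [x * y] in [A], and also in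
    [B], so it vanishes. The other side is the same with right annihilators. *)
Lemma C_of_lann A B C : A 0 -> is_ideal B -> (forall x, A x -> B x -> x = 0) ->
  is_ideal C -> subset_of C B -> subset_of (C_of A) (C_of (lann C)).
Proof.
move=> A0 hB AB hC CB c [cl cr]; case: (hB) => _ [_ [Bl Br]]; split=> x hx.
  move=> y Cy; apply: AB; last by apply/Bl/CB.
  by apply: cl; rewrite mulrA hx.
rewrite lann_rann // in hx *; move=> y Cy; apply: AB; last by apply/Br/CB.
by apply: cr; rewrite -mulrA hx.
Qed.

Lemma exists_minimal_prime B b : acc_left_annihilators R -> is_ideal B -> B b -> b <> 0 ->
  exists C, [/\ is_ideal C, subset_of C B & minimal_prime (lann C)].
Proof.
move=> acc hB Bb b0.
pose F C := [/\ is_ideal C, subset_of C B & exists2 x, C x & x <> 0].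
have [|C [[hC CB [x Cx x0]] maxC]] := @acc_maximal _ F B acc; first by split=> //; exists b.
exists C; split=> //; split.
  split; first exact: lann_ideal.
  split=> [h1|I J hI hJ IJ]; first by apply: x0; rewrite -(mul1r x); apply: h1.
  apply: contrapT => /not_orP[nI nJ].
  have [y Jy [z Cz yz]] : exists2 y, J y & exists2 z, C z & y * z <> 0.
    apply: contrapT => h; apply: nJ => y Jy z Cz; apply: contrapT => yz.
    by apply: h; exists y => //; exists z.
  have JC : subset_of (ideal_mul J C) C by apply: ideal_mul_subr.
  (* The nonzero ideal [J C] is a competitor, so its annihilator, which contains [I], is no larger
     than that of [C]. *)
  apply: nI => i Ii; apply: (maxC (ideal_mul J C)).
  - split; [exact: ideal_gen_ideal | by move=> w /JC /CB|].
    by exists (y * z) => //; apply: ideal_mul_in.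
  - exact: lann_antitone.
  - apply: sub_lann_ideal_mul i Ii => // i j w Ii Jj Cw.
    by rewrite mulrA IJ.
move=> Q [[Q0 _] [_ Qprime]] QC.
(* The product of [lann C] and [C] is zero, hence in [Q]; and [C] in [Q] would give [C] inside its
   own annihilator. *)
have [i j hi /hi -> //|//|CQ] := Qprime (lann C) C (lann_ideal hC) hC.
by case: x0; apply: (ideal_lann_eq0 hC) => //; apply/QC/CQ.
Qed.

(** Among the ideals with annihilator inside [P], take [B] with maximal annihilator. If [I J] kills
    [B], put [K = ann (J B)] and [L = ann (K B)]; then [L K] kills [B], so [P] contains [L] or [K],
    and maximality puts [J] or [I] in [lann B]. Thus [lann B] is prime, and equals [P] by
    minimality. *)
Lemma minimal_prime_lann P : acc_left_annihilators R -> minimal_prime P ->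
  exists B, [/\ is_ideal B, exists2 b, B b & b <> 0 & P = lann B].
Proof.
move=> acc [Pprime Pmin]; case: (Pprime) => -[P0 _] [P1 Pmul].
pose F B := is_ideal B /\ subset_of (lann B) P.
have [|B [[hB BP] maxB]] := @acc_maximal _ F (fun=> True) acc.
  by split=> // x /(_ 1 I); rewrite mulr1 => ->.
have Bneq0 : exists2 b, B b & b <> 0.
  apply: contrapT => h; apply/P1/BP => b Bb; apply: contrapT => b0.
  by apply: h; exists b => //; rewrite mul1r in b0.
exists B; split=> //; apply: subset_anti => //; apply: Pmin => //.
split; first exact: lann_ideal.
split=> [/BP //|I J hI hJ IJ]; apply: contrapT => /not_orP[nI nJ].
pose K := lann (ideal_mul J B); pose L := lann (ideal_mul K B).
have hK : is_ideal K by apply/lann_ideal/ideal_gen_ideal.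
have hL : is_ideal L by apply/lann_ideal/ideal_gen_ideal.
have IK : subset_of I K.
  by apply: sub_lann_ideal_mul => // x y z Ix Jy Bz; rewrite mulrA (IJ x y Ix Jy).
have JL : subset_of J L.
  (* In [j k b r j k b] the factor after [k] lies in the ideal [J B], which [k] kills. *)
  apply: sub_lann_ideal_mul => // j k b Jj Kk Bb; apply: semiprime_eq0 => r.
  case: hB => _ [_ [Bl _]].
  have /(ideal_mul_in Jj) JB : B (k * b) by apply: Bl.
  case: (ideal_gen_ideal (fun z => exists x y, [/\ J x, B y & z = x * y])) => _ [_ [Ml _]].
  by rewrite -!mulrA (mulrA b) (Kk _ (Ml (b * r) _ JB)) mulr0.
have [] : subset_of L P \/ subset_of K P.
  apply: Pmul => // l k Ll Kk; apply: BP => b Bb; rewrite -mulrA; apply: Ll.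
  exact: ideal_mul_in.
- move=> LP; apply: nJ => j Jj; apply: (maxB (ideal_mul K B)).
  + by split=> //; apply: ideal_gen_ideal.
  + by apply: lann_antitone; apply: ideal_mul_subr.
  + exact: JL.
- move=> KP; apply: nI => i Ii; apply: (maxB (ideal_mul J B)).
  + by split=> //; apply: ideal_gen_ideal.
  + by apply: lann_antitone; apply: ideal_mul_subr.
  + exact: IK.
Qed.

End Semiprime.

(** * Essential left ideals and regular elements *)

Section Essential.
Variable R : pzRingType.
Implicit Types (a b c r s x y z : R) (E I : R -> Prop).

(* For left ideals this is essentiality: tested on the principal ones [R x]. *)
Definition essential E : Prop := forall x, x <> 0 -> exists r, r * x <> 0 /\ E (r * x).

Lemma essential_residual r E : E 0 -> essential E -> essential (fun x => E (x * r)).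
Proof.
move=> E0 hE x x0; have [xr0|/hE [u [h1 h2]]] := EM (x * r = 0).
  by exists 1; rewrite mul1r xr0.
exists u; rewrite -mulrA; split=> // ux; apply: h1.
by rewrite mulrA ux mul0r.
Qed.

(** If every relation loses its leading term, from whatever index [k] it starts, induction on the
    length kills all terms, and the left ideals [R a_n] are independent. *)
Lemma finite_uniform_dimension_seq (a : nat -> R) : finite_uniform_dimension R ->
  (forall n, a n <> 0) ->
  ~ (forall (r : nat -> R) k n, \sum_(i < n.+1) r i * a (k + i)%N = 0 -> r 0%N * a k = 0).
Proof.
move=> fud a0 ha; apply: fud; exists (fun n x => exists r, x = r * a n).
split.
  move=> n; split; first by exists 0; rewrite mul0r.
  split=> [_ _ [r ->] [s ->]|s _ [r ->]]; first by exists (r - s); rewrite mulrBl.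
  by exists (s * r); rewrite mulrA.
split; first by move=> n; exists (a n); split=> //; exists 1; rewrite mul1r.
have indep n : forall (r : nat -> R) k, \sum_(i < n) r i * a (k + i)%N = 0 ->
    forall i, (i < n)%N -> r i * a (k + i)%N = 0.
  elim: n => // n IH r k e.
  have r0 := ha r k n e; case=> [|i] ik; first by rewrite addn0.
  rewrite big_ord_recl addn0 r0 add0r in e.
  rewrite -addSnnS; apply: (IH (fun i => r i.+1) k.+1) => //.
  by rewrite -[RHS]e; apply: eq_bigr => j _; rewrite addSnnS.
move=> n x hx sx i lin.
have /choice[r hr] : forall i, exists r, (i <= n)%N -> x i = r * a i.
  move=> j; have [/hx [r ->]|//] := boolP (j <= n)%N; first by exists r.
  by exists 0.
rewrite hr //; apply: (indep n.+1 r 0%N) => //.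
by rewrite -[RHS]sx; apply: eq_bigr => j _; rewrite hr // -ltnS.
Qed.

(* If [R x] met [R s + I] trivially then the sum of the [R x s^k] would be direct. *)
Lemma essential_principal_add I s : finite_uniform_dimension R -> I 0 ->
  (forall x, I (x * s) -> I x) -> essential (fun z => exists r y, I y /\ z = r * s + y).
Proof.
move=> fud I0 hs x x0; apply: contrapT => hx.
have hs' k y : I (y * s ^+ k) -> I y.
  by elim: k y => [|k IH] y; rewrite ?mulr1 // exprSr mulrA => /hs /IH.
have Ix r : (exists u y, I y /\ r * x = u * s + y) -> r * x = 0.
  by move=> h; apply: contrapT => rx; apply: hx; exists r.
apply: (@finite_uniform_dimension_seq (fun k => x * s ^+ k) fud).
  move=> k e; apply: x0; rewrite -(mul1r x); apply: Ix.
  by exists 0, x; rewrite mul0r add0r mul1r; split=> //; apply: (hs' k); rewrite e.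
move=> r k n e; rewrite mulrA Ix ?mul0r //.
(* With [s ^+ k] factored out, the relation reads [(r 0 * x + w * s) * s ^+ k = 0], so
   [r 0 * x + w * s] is in [I]. *)
pose w := \sum_(i < n) r i.+1 * x * s ^+ i.
have hw : (r 0%N * x + w * s) * s ^+ k = 0.
  rewrite -[RHS]e big_ord_recl addn0 mulrDl mulrA; congr (_ + _).
  rewrite !mulr_suml; apply: eq_bigr => i _.
  by rewrite -!mulrA -exprS -exprD lift0 (addnC (val i)) addSnnS.
exists (- w), (r 0%N * x + w * s); split; first by apply: (hs' k); rewrite hw.
by rewrite mulNr addrCA addNr addr0.
Qed.
End Essential.

(** * Regular elements of a semiprime left Goldie ring *)

Section Goldie.
Variable R : pzRingType.
Hypotheses (semiprimeR : semiprime R) (acc : acc_left_annihilators R).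
Implicit Types (a b c r s x y z : R) (A B C E I J P Q X : R -> Prop).

(** Otherwise choose [b <> 0] with [R b] nil and maximal left annihilator. For a suitable [y], the
    element [b * y] is a nonzero competitor killed by [b * x]; hence [b * x * b = 0] for all [x],
    against semiprimeness. *)
Lemma exists_non_nilpotent a : a <> 0 -> exists r, forall n, (r * a) ^+ n <> 0.
Proof.
move=> a0; apply: contrapT => hn.
pose nil b := forall r, exists n, (r * b) ^+ n = 0.
have nila : nil a.
  by move=> r; apply: contrapT => h; apply: hn; exists r => n e; apply: h; exists n.
have nilM b x : nil b -> nil (b * x).
  move=> hb r; have [n e] := hb (x * r); exists n.+1.
  have -> : (r * (b * x)) ^+ n.+1 = r * b * (x * r * b) ^+ n * x.
    elim: n {e} => [|n IH]; first by rewrite expr1 mulr1 mulrA.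
    by rewrite exprSr IH exprSr !mulrA.
  by rewrite e mulr0 mul0r.
pose F X := exists b, [/\ nil b, b <> 0 & X = eq b].
have [|X [[b [nilb b0 ->]] maxb]] := @acc_maximal _ F (eq a) acc; first by exists a.
apply/b0/(semiprime_eq0 semiprimeR) => x.
have [n e] : exists n, (b * x) ^+ n = 0 by have := nilM b x nilb 1; rewrite mul1r.
(* For the least [n] with [(b * x) ^+ n = 0], take [y = 1] if [n = 1], and otherwise
   [y = x * (b * x) ^+ (n - 2)]. *)
have [y [h1 h2]] : exists y, b * y <> 0 /\ b * x * (b * y) = 0.
  elim: n e => [|n IH] e.
    by case: b0; rewrite -[b]mulr1 -(expr0 (b * x)) e mulr0.
  have [/IH //|nz] := EM ((b * x) ^+ n = 0).
  case: n e nz {IH} => [|n] e nz.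
    exists 1; rewrite mulr1; split=> //.
    by rewrite expr1 in e; rewrite e mul0r.
  by exists (x * (b * x) ^+ n); rewrite mulrA -!exprS.
have : lann (eq b) (b * x); last exact.
by apply: (maxb (eq (b * y))); [exists (b * y); split=> //; apply: nilM
    |move=> r hr _ <-; rewrite mulrA hr // mul0r | move=> _ <-].
Qed.

Lemma exists_lann_square a : a <> 0 ->
  exists r, r * a <> 0 /\ forall u, u * (r * a) * (r * a) = 0 -> u * (r * a) = 0.
Proof.
move=> /exists_non_nilpotent [r hr]; set b := r * a in hr.
have [n u hu _ <-|N hN] := acc (X := fun n => eq (b ^+ n)).
  by rewrite exprSr mulrA hu // mul0r.
(* The left annihilators of the powers of [b] are constant from [N] on. The power [N.+1] is used so
   that the result is a left multiple of [a] even for [N = 0]. *)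
exists (b ^+ N * r); rewrite -mulrA -exprSr; split; first exact: hr.
move=> u; rewrite -mulrA -exprD => e.
have : lann (eq (b ^+ N)) u.
  by apply: (hN (N.+1 + N.+1)%N); [rewrite addSn -addnS leq_addr | move=> _ <-].
by move=> h; rewrite exprSr mulrA h // mul0r.
Qed.

(** If [x <> 0], take [b = r * x] for which [u * b * b = 0] forces [u * b = 0]. Essentiality gives
    [u * b <> 0] with [u * b * r] killing [x], that is [u * b * b = 0]. *)
Lemma left_nonsingular x : essential (lann (eq x)) -> x = 0.
Proof.
move=> hx; apply: contrapT => /exists_lann_square [r [b0 hb]].
have l0 : lann (eq x) 0 by move=> y _; rewrite mul0r.
have [u [ub0 hu]] := essential_residual r l0 hx b0.
by apply: ub0; apply: hb; rewrite -[RHS](hu x erefl) !mulrA.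
Qed.

Hypothesis fud : finite_uniform_dimension R.

(** Here [R c] is essential, and it kills every [x] with [c * x = 0]. *)
Lemma regular_of_lann0 c : (forall x, x * c = 0 -> x = 0) -> regular c.
Proof.
move=> hc; split=> // x cx; apply: left_nonsingular => z z0.
have [r [rz [u [_ [-> e]]]]] :=
  essential_principal_add (I := fun x => x = 0) fud erefl hc z0.
by exists r; split=> // _ <-; rewrite e addr0 -mulrA cx mulr0.
Qed.

(* Starting from [0], add to [c] in [E] elements [a] of [E] killed on the right by
   [c], so that [lann (c + a)] is the intersection of [lann c] and [lann a]. The
   left ideals [R a] are independent, hence the process stops. *)
Lemma essential_regular E : is_left_ideal E -> essential E -> exists2 c, E c & regular c.
Proof.
move=> [E0 [EB El]] hE; apply: contrapT => nreg.
have ED x y : E x -> E y -> E (x + y).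
  by move=> Ex Ey; rewrite -[y]opprK; apply: (EB) => //; rewrite -sub0r; apply: EB.
pose good c := E c /\ forall r, r * c * c = 0 -> r * c = 0.
have /choice[f fP] c : exists a, good c -> [/\ good a, a <> 0 & a * c = 0].
  have [[Ec hc]|ng] := EM (good c); last by exists 0.
  have [x xc x0] : exists2 x, x * c = 0 & x <> 0.
    apply: contrapT => h; apply: nreg; exists c => //; apply: regular_of_lann0 => x xc.
    by apply: contrapT => x0; apply: h; exists x.
  have [r [rx Er]] := hE x x0; have [u [b0 hb]] := exists_lann_square rx.
  exists (u * (r * x)) => _; split=> //; first by split=> //; apply: El.
  by rewrite -!mulrA xc !mulr0.
have lann_add c r : good c -> r * (c + f c) = 0 -> r * c = 0 /\ r * f c = 0.
  move=> gc; have [_ _ ac] := fP c gc; rewrite mulrDr => e.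
  have rc : r * c = 0.
    apply: (gc.2); have := congr1 (fun x => x * c) e.
    by rewrite mul0r mulrDl -(mulrA r (f c)) ac mulr0 addr0.
  by move: e; rewrite rc add0r.
have good_add c : good c -> good (c + f c).
  move=> gc; have [[Ea ha] _ ac] := fP c gc; split; first by apply: ED => //; case: gc.
  move=> r /(lann_add _ _ gc) [e1 e2].
  have rc : r * c = 0.
    by apply: (gc.2); move: e1; rewrite mulrDr mulrDl -(mulrA r (f c)) ac mulr0 addr0.
  by move: e2; rewrite mulrDr rc add0r; apply: ha.
pose c n := iter n (fun c => c + f c) 0.
have gc n : good (c n).
  elim: n => [|n IH]; last exact: (good_add (c n)).
  split; first exact: E0.
  by move=> r _; apply: mulr0.
have lannc r m n : (m <= n)%N -> r * c n = 0 -> r * c m = 0.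
  move=> /subnK <-; elim: (n - m)%N => // k IH.
  by rewrite addSn => /(lann_add _ _ (gc _)) [/IH].
apply: (@finite_uniform_dimension_seq _ (fun n => f (c n)) fud).
  by move=> n; case: (fP _ (gc n)).
move=> r k n e; case: (fP _ (gc k)) => -[_ hk] _ _; apply: hk.
(* Each later [f (c i)] kills [c i], hence [c k.+1], hence [f (c k)] from the left; only the square
   of [f (c k)] survives. *)
move/(congr1 (fun x => x * f (c k))): e.
rewrite mul0r mulr_suml big_ord_recl big1 ?addr0 ?addn0 // => i _.
rewrite -mulrA; suff -> : f (c (k + lift ord0 i)%N) * f (c k) = 0 by rewrite mulr0.
apply: (proj2 (lann_add _ _ (gc k) _)).
case: (fP _ (gc (k + lift ord0 i)%N)) => _ _.
by apply: (lannc _ k.+1); rewrite lift0 addnS ltnS leq_addr.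
Qed.

(** [A + ann A] is essential: a nonzero [z] either lies in the right annihilator of [A], which
    equals the left one, or has a nonzero multiple [x * z] in [A]. *)
Lemma ideal_add_lann_regular A : is_ideal A ->
  exists x y, [/\ A x, lann A y & regular (x + y)].
Proof.
move=> hA; have hB := lann_ideal hA; rewrite !lann_rann // in hB *.
case: (hA) (hB) => A0 [AB [Al Ar]] [B0 [BB [Bl _]]].
have [||_ [x [y [Ax By ->]]] creg] :=
    @essential_regular (fun z => exists x y, [/\ A x, rann A y & z = x + y]).
- split; first by exists 0, 0; rewrite addr0.
  split=> [_ _ [x [y [Ax By ->]]] [x' [y' [Ax' By' ->]]]|r _ [x [y [Ax By ->]]]].
    by exists (x - x'), (y - y'); rewrite opprD addrACA; split; [apply: AB|apply: BB|].
  by exists (r * x), (r * y); rewrite mulrDr; split; [apply: Al|apply: Bl|].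
- move=> z z0; have [Bz|nBz] := EM (rann A z).
    by exists 1; rewrite mul1r; split=> //; exists 0, z; rewrite add0r.
  have [x Ax xz] : exists2 x, A x & x * z <> 0.
    by apply: contrapT => h; apply: nBz => x Ax; apply: contrapT => xz; apply: h; exists x.
  by exists x; split=> //; exists (x * z), 0; rewrite addr0; split=> //; apply: Ar.
by exists x, y.
Qed.

Lemma C_of_sub_minimal_prime A : is_ideal A -> (forall c, regular c -> ~ A c) ->
  exists2 P, minimal_prime P & subset_of (C_of A) (C_of P).
Proof.
move=> hA nreg; have [x [y [Ax By creg]]] := ideal_add_lann_regular hA.
have hB := lann_ideal hA.
have y0 : y <> 0 by move=> y0; apply: (nreg _ creg); rewrite y0 addr0.
have [C [hC CB Cmin]] := exists_minimal_prime semiprimeR acc hB By y0.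
exists (lann C) => //; apply: (C_of_lann semiprimeR _ hB) => //; first by case: hA.
by move=> z; apply: ideal_lann_eq0.
Qed.

Lemma regular_sub_C_of P c : minimal_prime P -> regular c -> C_of P c.
Proof.
move=> /(minimal_prime_lann semiprimeR acc) [B [hB _ ->]].
by apply: (C_of_lann semiprimeR (A := fun x => x = 0) _ (setT_ideal R)).
Qed.

(** In a regular [x + y] with [x] in [P] and [y] in [ann P], the summand [y] is congruent to a
    regular element modulo [P]. *)
Lemma exists_C_of_lann P : minimal_prime P -> exists2 y, C_of P y & lann P y.
Proof.
move=> minP; have [[hP _] _] := minP.
have [x [y [Px Ly /(regular_sub_C_of minP) [cl cr]]]] := ideal_add_lann_regular hP.
case: (hP) => _ [_ [Pl Pr]].
exists y => //; split=> z hz.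
  by apply: cl; rewrite mulrDl; apply: ideal_add => //; apply: Pr.
by apply: cr; rewrite mulrDr; apply: ideal_add => //; apply: Pl.
Qed.

Lemma C_of_sub_eq P Q : minimal_prime P -> minimal_prime Q ->
  subset_of (C_of P) (C_of Q) -> P = Q.
Proof.
move=> minP minQ PQ; have [[hP _] _] := minP; have [[hQ [Q1 Qmul]] _] := minQ.
have [y Cy Ly] := exists_C_of_lann minP.
have QP : subset_of P Q.
  (* [lann P] times [P] is zero. Were [lann P] inside [Q], then [y] would be in [Q] and regular
     modulo [Q], forcing [1] into [Q]. *)
  have [i j Li Pj|LQ|//] := Qmul (lann P) P (lann_ideal hP) hP.
    by rewrite Li //; case: hQ.
  case: Q1; have [h _] := PQ y Cy.
  by apply: h; rewrite mulr1; apply: LQ.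
by apply: subset_anti => //; case: minQ => _; apply=> //; case: minP.
Qed.

(** Left multiplication by [y] in [ann P] turns congruences modulo [P] into equalities. For the Ore
    condition, [R s + P] is essential, so a regular [c] satisfies [c * r = u * s + p], and [y]
    removes [p]. *)
Lemma C_of_left_denominator P : minimal_prime P -> left_denominator (C_of P).
Proof.
move=> minP; have [[hP [P1 _]] _] := minP; case: (hP) => P0 [PB [Pl Pr]].
have [y Cy Ly] := exists_C_of_lann minP.
have CM s t : C_of P s -> C_of P t -> C_of P (s * t).
  by move=> [sl sr] [tl tr]; split=> x; [rewrite -mulrA => /sl /tl | rewrite mulrA => /tr /sr].
split.
  split; first by split=> x; rewrite ?mulr1 ?mul1r.
  by split=> // -[h _]; apply/P1/h; rewrite mul0r.
split=> [r s Cs|r s [_ sr] rs0]; last first.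
  by exists y; split=> //; apply/Ly/sr; rewrite rs0.
have essD := essential_principal_add fud P0 Cs.2.
have D0 : exists r y, P y /\ 0 = r * s + y by exists 0, 0; rewrite mul0r addr0.
have [|c [u [p [Pp e]]] /(regular_sub_C_of minP) Cc] :=
    essential_regular _ (essential_residual r D0 essD).
  split; first by rewrite mul0r.
  split=> [a b [u [p [Pp e]]] [v [q [Pq e']]]|a b [u [p [Pp e]]]].
    exists (u - v), (p - q); rewrite !mulrBl e e' opprD addrACA; split=> //; exact: PB.
  by exists (a * u), (a * p); rewrite -!mulrA e mulrDr; split=> //; apply: Pl.
exists (y * c), (y * u); split; first exact: CM.
by rewrite -!mulrA e mulrDr (Ly p Pp) addr0.
Qed.
End Goldie.

(** * Maximal localizations *)

Section MaximalLocalizations.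
Variable R : pzRingType.
Hypotheses (semiprimeR : semiprime R) (acc : acc_left_annihilators R)
  (fud : finite_uniform_dimension R).
Implicit Types (S P : R -> Prop).

Lemma left_denominator_sub S : left_denominator S ->
  exists2 P, minimal_prime P & subset_of S (C_of P).
Proof.
move=> denS; have [|P minP sub] :=
    C_of_sub_minimal_prime semiprimeR acc fud (torsion_ideal denS).
  move=> c [_ creg] [t [St tc]]; case: denS => -[_ [S0 _]] _.
  by apply: S0; rewrite -(creg t tc).
by exists P => // s Ss; apply/sub/(torsion_C_of denS).
Qed.

(** Regular elements become invertible in the nonzero ring [A], so none is in the kernel of [phi];
    and elements of [S] are regular modulo that kernel. *)
Lemma left_localizable_sub S : left_localizable S -> (forall c, regular c -> S c) ->
  exists2 P, minimal_prime P & subset_of S (C_of P).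
Proof.
move=> [_ [A [phi [[[phiB [phiM _]] [phi_inv _]] [A1 _]]]]] regS.
have phi0 : phi 0 = 0 by rewrite -(subrr 0) phiB subrr.
have kerI : is_ideal (fun x => phi x = 0).
  split=> //; split=> [x y x0 y0|]; first by rewrite phiB x0 y0 subr0.
  by split=> r x x0; rewrite phiM x0 ?mulr0 ?mul0r.
have [|P minP sub] := C_of_sub_minimal_prime semiprimeR acc fud kerI.
  by move=> c /regS /phi_inv [u [cu _]] c0; apply: A1; rewrite -cu c0 mul0r.
exists P => // s /phi_inv [u [su us]]; apply: sub.
split=> x; rewrite phiM => e.
  by rewrite -[LHS]mul1r -us -mulrA e mulr0.
by rewrite -[LHS]mulr1 -su mulrA e mul0r.
Qed.

(* [F] is either the property of being a left denominator set or that of being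
   left localizable and containing the regular elements. *)
Lemma maximal_in_C_of (F : (R -> Prop) -> Prop) S :
  (forall P, minimal_prime P -> F (C_of P)) ->
  (forall T, F T -> exists2 P, minimal_prime P & subset_of T (C_of P)) ->
  maximal_in F S <-> exists2 P, minimal_prime P & S = C_of P.
Proof.
move=> FC Fsub; split=> [[FS maxS]|[P minP ->]].
  have [P minP SP] := Fsub S FS.
  by exists P => //; apply: subset_anti => //; apply: maxS => //; apply: FC.
split=> [|T FT PT]; first exact: FC.
have [Q minQ TQ] := Fsub T FT.
suff -> : P = Q by [].
by apply: (C_of_sub_eq semiprimeR acc fud minP minQ) => c /PT /TQ.
Qed.

Lemma max_left_denominator_C_of S :
  max_left_denominator S <-> exists2 P, minimal_prime P & S = C_of P.
Proof.
apply: maximal_in_C_of left_denominator_sub => P.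
exact: (C_of_left_denominator semiprimeR acc fud).
Qed.

Lemma max_left_localizable_C_of S :
  (max_left_localizable S /\ (forall c, regular c -> S c)) <->
  exists2 P, minimal_prime P & S = C_of P.
Proof.
(* Any set above [S] inherits the regular elements, so maximality among all left localizable sets
   agrees with maximality among those containing them. *)
rewrite -(maximal_in_C_of (F := fun S => left_localizable S /\ forall c, regular c -> S c)).
- split=> [[[locS maxS] regS]|[[locS regS] maxS]].
    by split=> // T [locT _]; apply: maxS.
  split=> //; split=> // T locT ST.
  by apply: maxS => //; split=> // c /regS /ST.
- move=> P minP; split; last by move=> c; apply: (regular_sub_C_of semiprimeR acc).
  exact/left_denominator_localizable/(C_of_left_denominator semiprimeR acc fud).
- by move=> T []; apply: left_localizable_sub.
Qed.
End MaximalLocalizations.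

Theorem theorem1p12 (R : nzRingType) :
  semiprime R -> left_Goldie R ->
  (forall S : R -> Prop,
     (max_left_localizable S /\ (forall c : R, regular c -> S c))
     <-> max_left_denominator S) /\
  (forall S : R -> Prop,
     max_left_denominator S <->
     exists P : R -> Prop, minimal_prime P /\ forall c : R, S c <-> C_of P c).
Proof.
move=> semiprimeR [acc fud]; split=> S.
  by rewrite max_left_localizable_C_of // max_left_denominator_C_of.
rewrite max_left_denominator_C_of //.
split=> [[P minP ->]|[P [minP SP]]]; first by exists P.
by exists P => //; apply: subset_anti => c /SP.
Qed.
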